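(* Let $H=-A+V$ have spectral gap $\Delta$ and a log-concave ground state with mean $\mu$ and variance $\sigma^2$. Let $h:\{0,1,\dots,n\}\to\mathbb{R}_{\ge0}$ be supported on an integer interval $[\ell,u-1]\subseteq[0,n]$ and satisfy $h(k)\le\bar h$ for all $k$. Let $\alpha=\max\{\mu-u,\ \ell-\mu\}$. If $$\bar h\cdot\min\left\{\frac{2(u-\ell)}{\sqrt{1+4\sigma^2}},\ 2\exp\left(-\frac{\alpha}{2(2\sigma+1)}\right)\right\}\ \le\ \frac{\Delta}{2},$$ then the perturbed Hamiltonian $H'=H+V'$, where $V'$ is the diagonal matrix with entries $h(0),\dots,h(n)$, has spectral gap $\Delta'\ge\Delta/2$.
   Context: $n\ge1$, $V:\{0,\dots,n\}\to\mathbb{R}$, and $H=-A+V$ is the real symmetric $(n+1)\times(n+1)$ matrix indexed by $\{0,\dots,n\}$, where $V$ acts as the diagonal matrix with entries $V(0),\dots,V(n)$ and $A_{k-1,k}=A_{k,k-1}=a_k>0$ for $1\le k\le n$, all other entries of $A$ being $0$. The spectral gap is the difference between the two lowest eigenvalues (counted with multiplicity). The lowest eigenvalue of $H$ is simple and its normalized eigenvector (ground state) $(\psi_k)_{k=0}^n$ is chosen with positive entries; its mean $\mu$ and variance $\sigma^2$ (with $\sigma\ge0$) are those of the probability distribution $p_k=\psi_k^2$ on $\{0,\dots,n\}$. The ground state is log-concave if $\psi_k^2\ge\psi_{k-1}\psi_{k+1}$ for $0<k<n$ (equivalently $\{p_k\}$ is log-concave). *)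

(* Defs.v *)
From HB Require Import structures.
From mathcomp Require Import all_boot all_order all_algebra.
From mathcomp Require Import polyrcf.
From mathcomp Require Import reals.

Set Implicit Arguments.
Unset Strict Implicit.
Unset Printing Implicit Defensive.

Import Order.TTheory GRing.Theory Num.Theory.
Local Open Scope ring_scope.

(* Real eigenvalues in increasing order, repeated according to their
   multiplicity as roots of the characteristic polynomial; [rootsR] lists the
   distinct real roots in increasing order.  For a real symmetric matrix these
   are all the eigenvalues, and algebraic and geometric multiplicities agree. *)
Definition spectrum (R : rcfType) (m : nat) (M : 'M[R]_m) : seq R :=
  flatten [seq nseq (mup x (char_poly M)) x | x <- rootsR (char_poly M)].

(* A symmetric matrix of size at least 2 has at least two entries in its
   spectrum, so the default value of [_`_i] plays no role there. *)
Definition spectral_gap (R : rcfType) (m : nat) (M : 'M[R]_m) : R :=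
  (spectrum M)`_1 - (spectrum M)`_0.

(* When the characteristic polynomial splits, [spectrum] is the
   sorted list of its roots with multiplicity. *)
Lemma spectrum_prod_XsubC (R : rcfType) (m : nat) (M : 'M[R]_m) (s : seq R) :
  char_poly M = \prod_(x <- s) ('X - x%:P) -> spectrum M = sort <=%R s.
Proof.
move=> Ms; have M0 : char_poly M != 0 by rewrite monic_neq0 ?char_poly_monic.
have rM : rootsR (char_poly M) =i undup s.
  move=> x; rewrite mem_undup -(root_prod_XsubC s) -Ms.
  by have := roots_on_rootsR M0 x; rewrite in_itv /=.
have srt : sorted <%R (rootsR (char_poly M)) by exact: sorted_roots.
apply: (@sorted_eq _ <=%R); [exact: le_trans | exact: le_anti | | |].
- rewrite /spectrum; elim: (rootsR _) srt => [//|x r IHr] xr.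
  have {}IHr := IHr (path_sorted xr).
  rewrite /= sorted_pairwise ?pairwise_cat; last exact: le_trans.
  rewrite -!sorted_pairwise; try exact: le_trans.
  rewrite IHr andbT; apply/andP; split; last first.
    by elim: (mup _ _) => [//|[//|k] IHk] /=; rewrite lexx.
  apply/allrelP => y z /nseqP[-> _] /flattenP[_ /mapP[t tr ->]] /nseqP[-> _].
  by rewrite ltW //; move: xr => /(order_path_min lt_trans)/allP; exact.
- by apply: sort_sorted; exact: le_total.
- rewrite perm_sym perm_sort perm_sym; apply/allP => x _ /=; apply/eqP.
  rewrite /spectrum count_flatten -map_comp sumnE big_map.
  rewrite (eq_bigr (fun y => (y == x) * count_mem y s)%N); last first.
    by move=> y _ /=; rewrite count_nseq /= Ms mu_prod_XsubC.
  have ur : uniq (rootsR (char_poly M)) by exact: (sorted_uniq lt_trans ltxx).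
  have [xs|xs] := boolP (x \in s).
    rewrite (bigD1_seq x) ?rM ?mem_undup //= eqxx mul1n big1 ?addn0 //.
    by move=> y /negPf ->.
  rewrite (count_memPn xs) big1 // => y _.
  by have [->|] := eqVneq y x; rewrite ?(count_memPn xs).
Qed.

(* [a k] is the entry in positions (k-1,k) and (k,k-1), for 1 <= k <= n. *)
Definition hopping (R : realType) (n : nat) (a : nat -> R) : 'M[R]_n.+1 :=
  \matrix_(i < n.+1, j < n.+1)
    if j == i.+1 :> nat then a j else if i == j.+1 :> nat then a i else 0.

Definition potential (R : realType) (n : nat) (V : 'I_n.+1 -> R) :
    'M[R]_n.+1 := diag_mx (\row_k V k).

Definition hamiltonian (R : realType) (n : nat) (a : nat -> R)
    (V : 'I_n.+1 -> R) : 'M[R]_n.+1 := - hopping n a + potential V.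

Definition is_ground_state (R : realType) (n : nat) (H : 'M[R]_n.+1)
    (psi : 'cV[R]_n.+1) : Prop :=
  [/\ H *m psi = (spectrum H)`_0 *: psi,
      \sum_k psi k 0 ^+ 2 = 1 &
      forall k, 0 < psi k 0].

Definition log_concave (R : realType) (n : nat) (psi : 'cV[R]_n.+1) : Prop :=
  forall i j k : 'I_n.+1, j = i.+1 :> nat -> k = j.+1 :> nat ->
    psi i 0 * psi k 0 <= psi j 0 ^+ 2.

Definition gs_mean (R : realType) (n : nat) (psi : 'cV[R]_n.+1) : R :=
  \sum_(k < n.+1) k%:R * psi k 0 ^+ 2.

Definition gs_variance (R : realType) (n : nat) (psi : 'cV[R]_n.+1) : R :=
  \sum_(k < n.+1) (k%:R - gs_mean psi) ^+ 2 * psi k 0 ^+ 2.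

(* Main.v *)
Require Import Defs.
From mathcomp Require Import all_boot all_order all_algebra.
From mathcomp Require Import reals sequences exp.
From mathcomp Require Import complex spectral sesquilinear.
From mathcomp Require Import ring lra zify.

(* Testing [H'] on the ground state gives
   [lambda_0' <= lambda_0 + sum_k (h k) p_k], and [lambda_1' >= lambda_1] by
   Courant-Fischer (over the complex numbers, where the spectral theorem is
   available), so the gap drops by at most [hbar] times the mass that
   [p_k = psi_k^2] gives to [l, u - 1].  That mass is bounded in two ways.
   (i) [p_m <= 2 / sqrt (1 + 4 sigma^2)] for all [m]: the [r]-fold iterated tail
   sums [B_r] at [0] of a log-concave sequence on the naturals satisfy
   [B_(r-1) B_(r+1) <= B_r^2], with equality for geometric sequences.  Applied
   for [r <= 2] to both sides of [m], this bounds the variance by that of a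
   two-sided geometric sequence.
   (ii) The tails decay like [exp (- t / (4 sigma + 2))]: by Chebyshev's
   inequality the tail sums drop by a factor 3 across a window of length at most
   [4 sigma + 2] around the mean, and they are log-concave, so they drop at least
   as much across every later window of that length; reflecting the sequence
   treats the other tail. *)

Set Implicit Arguments.
Unset Strict Implicit.
Unset Printing Implicit Defensive.

Import Order.TTheory GRing.Theory Num.Theory.
Local Open Scope ring_scope.

(** * Eigenvalues of a symmetric matrix *)

Section Spectrum.
Local Open Scope sesquilinear_scope.
Variable R : rcfType.
Local Notation C := R[i].
Local Notation toC := (real_complex R).
Local Notation "A ^toC" := (map_mx toC A) (at level 30).

(** The rows of [P] are orthonormal left eigenvectors of [A], listed in no particular order. *)
Definition eigensystem m (A : 'M[R]_m) (P : 'M[C]_m) (d : 'I_m -> R) : Prop :=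
  [/\ P \is unitarymx,
      A ^toC = P^t* *m diag_mx (\row_i toC (d i)) *m P &
      spectrum A = sort <=%R [seq d i | i : 'I_m]].

Lemma char_poly_conj (F : comUnitRingType) m (P A : 'M[F]_m) :
  P \in unitmx -> char_poly (invmx P *m A *m P) = char_poly A.
Proof.
move=> Pu; rewrite /char_poly /char_poly_mx.
have -> : 'X%:M - map_mx polyC (invmx P *m A *m P) =
    map_mx polyC (invmx P) *m ('X%:M - map_mx polyC A) *m map_mx polyC P.
  rewrite mulmxBr mulmxBl -!map_mxM mul_mx_scalar -scalemxAl -map_mxM.
  by rewrite mulVmx // map_mx1 scalemx1.
rewrite !det_mulmx mulrAC -det_mulmx -map_mxM mulVmx // map_mx1 det1 mul1r //.
Qed.

Lemma symmetric_eigensystem m (A : 'M[R]_m) :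
  A^T = A -> exists P d, eigensystem A P d.
Proof.
move=> Asym.
have hA : A ^toC \is hermsymmx.
  apply: realsym_hermsym.
    apply/is_hermitianmxP; rewrite expr0 scale1r map_mx_id //.
    by rewrite map_trmx Asym.
  by apply/mxOverP => i j; rewrite mxE complex_real.
pose P := spectralmx (A ^toC).
have Pu : P \is unitarymx := spectral_unitarymx _.
have dR : forall i, spectral_diag (A ^toC) 0 i \is Num.real.
  by move=> i; apply: (mxOverP (hermitian_spectral_diag_real hA)).
pose d i := complex.Re (spectral_diag (A ^toC) 0 i).
have dE : spectral_diag (A ^toC) = \row_i toC (d i).
  by apply/rowP => i; rewrite mxE /d (RRe_real (dR i)).
have AE : A ^toC = P^t* *m diag_mx (\row_i toC (d i)) *m P.
  by rewrite -dE -invmx_unitary //; exact/orthomx_spectralP/hermitian_normalmx.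
exists P, d; split => //; apply: spectrum_prod_XsubC.
apply: (map_poly_inj toC); rewrite map_char_poly.
rewrite AE -invmx_unitary // char_poly_conj ?unitarymx_unit //.
rewrite char_poly_trig ?diag_mx_is_trig // rmorph_prod /= big_map big_enum /=.
by apply: eq_bigr => i _; rewrite map_polyXsubC !mxE eqxx mulr1n.
Qed.

Lemma spectrum_low m (A : 'M[R]_m.+2) P d : eigensystem A P d ->
  exists i0 i1, [/\ i0 != i1, (spectrum A)`_0 = d i0, (spectrum A)`_1 = d i1,
    forall j, d i0 <= d j & forall j, j != i0 -> d i1 <= d j].
Proof.
(* Sorting the indices instead of the values keeps [i0] and [i1] distinct even when the two lowest
   eigenvalues coincide. *)
case=> _ _ ->; rewrite /image_mem -/(map _ _) sort_map.
set t := sort _ _.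
have tp : perm_eq t (enum 'I_m.+2) by rewrite perm_sort.
have st : sorted (relpre d <=%R) t by apply: sort_sorted => x y; exact: le_total.
have ut : uniq t by rewrite (perm_uniq tp) enum_uniq.
have mt j : j \in t by rewrite (perm_mem tp) mem_enum.
have sz : size t = m.+2 by rewrite (perm_size tp) size_enum_ord.
case: t st ut mt sz {tp} => [|i0 [|i1 t]] //= st ut mt _.
have tr : transitive (relpre d <=%R) by move=> x y z; exact: le_trans.
have /andP[i01 it] := st.
exists i0, i1; split => //.
- by move: ut; rewrite !inE negb_or -!andbA => /andP[].
- move=> j; have := mt j; rewrite !inE => /or3P[/eqP->|/eqP->|jt] //=.
  by apply: (le_trans i01); move/(order_path_min tr)/allP: it; exact.
- move=> j /negPf ji0; have := mt j; rewrite !inE ji0 /= => /orP[/eqP->|jt] //=.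
  by move/(order_path_min tr)/allP: it; exact.
Qed.

Lemma eigensystem_form m (A : 'M[R]_m) P d (v : 'rV[C]_m) :
  eigensystem A P d -> let c i := (v *m P^t*) 0 i in
  (v *m v^t*) 0 0 = \sum_i c i * (c i)^* /\
  (v *m A ^toC *m v^t*) 0 0 = \sum_i toC (d i) * (c i * (c i)^*).
Proof.
case=> Pu AE _ c; pose w := v *m P^t*.
have vE : v = w *m P by rewrite /w mulmxKtV.
have wE : P *m v^t* = w^t* by rewrite /w trmx_mul map_mxM -map_trmx trmxCK.
split.
  rewrite {1}vE -mulmxA wE mxE; apply: eq_bigr => i _.
  by congr (_ * _); rewrite mxE [w^T _ _]mxE.
rewrite AE !mulmxA -/w -mulmxA wE mul_mx_diag mxE; apply: eq_bigr => i _.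
rewrite mxE [X in w 0 i * X]mxE mulrCA mulrA; congr (_ * _ * _).
by rewrite mxE [w^T _ _]mxE.
Qed.

Lemma spectrum0_le_rayleigh m (A : 'M[R]_m.+2) (v : 'rV[R]_m.+2) :
  A^T = A -> (spectrum A)`_0 * \sum_i v 0 i ^+ 2 <= (v *m A *m v^T) 0 0.
Proof.
move=> /symmetric_eigensystem[P [d Ad]].
have [i0 [i1 [_ -> _ d0 _]]] := spectrum_low Ad.
have [nE fE] := eigensystem_form (v ^toC) Ad.
have vT : (v ^toC)^t* = (v^T) ^toC.
  by apply/matrixP => i j; rewrite !mxE; apply: conjc_real.
rewrite vT -!map_mxM [LHS]mxE /= in nE; rewrite vT -!map_mxM [LHS]mxE /= in fE.
rewrite -lecR fE rmorphM /=.
have -> : toC (\sum_i v 0 i ^+ 2) = toC ((v *m v^T) 0 0).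
  by congr toC; rewrite mxE; apply: eq_bigr => i _; rewrite mxE expr2.
rewrite nE mulr_sumr ler_sum // => i _.
by rewrite ler_wpM2r ?mul_conjC_ge0 // lecR.
Qed.

(* Courant-Fischer: the span of the two lowest eigenvectors of [B] contains a
   nonzero vector orthogonal to the lowest eigenvector of [A]. *)
Lemma spectrum1_mono m (A B : 'M[R]_m.+2) : A^T = A -> B^T = B ->
  (forall v : 'rV[C]_m.+2,
    (v *m A ^toC *m v^t*) 0 0 <= (v *m B ^toC *m v^t*) 0 0) ->
  (spectrum A)`_1 <= (spectrum B)`_1.
Proof.
move=> /symmetric_eigensystem[P [d Ad]] /symmetric_eigensystem[Q [e Be]] AB.
have [i0 [i1 [_ _ -> _ d1]]] := spectrum_low Ad.
have [j0 [j1 [j01 _ -> e0 _]]] := spectrum_low Be.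
pose x := row j0 Q; pose y := row j1 Q.
pose al := (x *m P^t*) 0 i0; pose be := (y *m P^t*) 0 i0.
have [a [b [ab0 abP]]] : exists a b : C,
    0 < a * a^* + b * b^* /\ a * al + b * be = 0.
  have [al0|al0] := eqVneq al 0.
    exists 1, 0; rewrite al0 mulr0 !mul0r !addr0 mul1r.
    by rewrite rmorph1 ltr01.
  exists be, (- al); rewrite [- al * be]mulNr [al * be]mulrC subrr; split => //.
  by rewrite ltr_wpDl ?mul_conjC_ge0 // mul_conjC_gt0 oppr_eq0.
pose v := a *: x + b *: y.
have [nA fA] := eigensystem_form v Ad; have [nB fB] := eigensystem_form v Be.
have cA : (v *m P^t*) 0 i0 = 0.
  by rewrite -abP /al /be mulmxDl -!scalemxAl !mxE.
have cB j : (v *m Q^t*) 0 j = a *+ (j == j0) + b *+ (j == j1).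
  have [Qu _ _] := Be.
  rewrite mulmxDl -!scalemxAl -!row_mul (unitarymxP Qu) !row1 !mxE eqxx /=.
  by rewrite !mulr_natr.
have sumB (f : 'I_m.+2 -> C) :
    \sum_i f i * ((v *m Q^t*) 0 i * ((v *m Q^t*) 0 i)^*) =
    f j0 * (a * a^*) + f j1 * (b * b^*).
  rewrite (bigD1 j0) //= (bigD1 j1) 1?eq_sym //= big1 ?addr0; last first.
    by move=> j /andP[/negPf h0 /negPf h1]; rewrite cB h0 h1 addr0 mul0r mulr0.
  by rewrite !cB !eqxx [j1 == j0]eq_sym (negPf j01) addr0 add0r.
have nv : (v *m v^t*) 0 0 = a * a^* + b * b^*.
  transitivity (\sum_i 1 * ((v *m Q^t*) 0 i * ((v *m Q^t*) 0 i)^*)).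
    by rewrite nB; apply: eq_bigr => i _; rewrite mul1r.
  by rewrite (sumB (fun=> 1)) !mul1r.
(* [v] has no component along the lowest eigenvector of [A], and only components with eigenvalue at
   most [e j1] for [B]; the forms of [A] and [B] at [v] thus lie between [d i1] and [e j1] times its
   squared norm. *)
have lo : toC (d i1) * (v *m v^t*) 0 0 <= (v *m A ^toC *m v^t*) 0 0.
  rewrite nA fA mulr_sumr ler_sum // => i _.
  have [->|ii0] := eqVneq i i0; first by rewrite cA !mul0r !mulr0.
  by rewrite ler_wpM2r ?mul_conjC_ge0 // lecR d1.
have hi : (v *m B ^toC *m v^t*) 0 0 <= toC (e j1) * (v *m v^t*) 0 0.
  rewrite fB (sumB (fun j => toC (e j))) nv mulrDr lerD2r.
  by rewrite ler_wpM2r ?mul_conjC_ge0 // lecR.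
have := le_trans lo (le_trans (AB v) hi).
by rewrite ler_pM2r ?nv // lecR.
Qed.
End Spectrum.

(** * Loss of spectral gap under a nonnegative diagonal perturbation *)

Section Gap.
Variable R : realType.

Lemma hamiltonian_sym n a (V : 'I_n.+1 -> R) :
  (hamiltonian a V)^T = hamiltonian a V.
Proof.
rewrite /hamiltonian /potential linearD linearN /= tr_diag_mx.
congr (- _ + _); apply/matrixP => i j; rewrite !mxE.
have [ji|ji] := eqVneq (j : nat) i.+1; last by case: eqP.
by rewrite ji ltn_eqF // ltnW.
Qed.

Lemma spectral_gap_perturb n (A : 'M[R]_n.+1) (psi : 'cV[R]_n.+1)
    (h : 'I_n.+1 -> R) : (0 < n)%N ->
  A^T = A -> is_ground_state A psi -> (forall k, 0 <= h k) ->
  spectral_gap A - \sum_k h k * psi k 0 ^+ 2 <= spectral_gap (A + potential h).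
Proof.
case: n A psi h => // n A psi h _ As [psiE psi1 _] h0.
have Bs : (A + potential h)^T = A + potential h.
  by rewrite linearD /= As /potential tr_diag_mx.
have l1 : (spectrum A)`_1 <= (spectrum (A + potential h))`_1.
  apply: spectrum1_mono => // v.
  rewrite map_mxD mulmxDr mulmxDl [leRHS]mxE lerDl /potential map_diag_mx mul_mx_diag.
  rewrite mxE sumr_ge0 // => i _; rewrite mxE !mxE mulrAC.
  by rewrite mulr_ge0 ?mul_conjC_ge0 // ler0c.
have := spectrum0_le_rayleigh psi^T Bs.
rewrite trmxK (eq_bigr (fun i => psi i 0 ^+ 2)) => [|i _]; last by rewrite mxE.
rewrite psi1 mulr1 -mulmxA mulmxDl psiE mulmxDr -scalemxAr mxE.
have -> : (psi^T *m (potential h *m psi)) 0 0 = \sum_k h k * psi k 0 ^+ 2.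
  rewrite mul_diag_mx mxE; apply: eq_bigr => k _.
  by rewrite !mxE mulrCA expr2.
have -> : ((spectrum A)`_0 *: (psi^T *m psi)) 0 0 = (spectrum A)`_0.
  rewrite mxE -[RHS]mulr1 -psi1 mxE; congr (_ * _).
  by apply: eq_bigr => i _; rewrite mxE expr2.
rewrite /spectral_gap => l0; lra.
Qed.
End Gap.

(** * Finite log-concave sequences *)

Section LogConcave.
Variable R : realFieldType.
Implicit Types (f g w : nat -> R) (N : nat).

(** The ratio [f (j + d) / f j] does not increase with [j]; clearing denominators allows for zeros
    of [f]. *)
Definition lcseq f := forall i j d : nat, (j <= i)%N ->
  f (i + d)%N * f j <= f i * f (j + d)%N.

Definition finseq N f := (forall k, 0 <= f k) /\ (forall k, (N <= k)%N -> f k = 0).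

Definition tail N f j := \sum_(j <= k < N) f k.

Lemma finseq_tail N f : finseq N f -> finseq N (tail N f).
Proof.
case=> f0 fN; split=> k; first by apply: sumr_ge0.
by move=> Nk; rewrite /tail big_geq.
Qed.

Lemma tail_addn N f j d : finseq N f ->
  tail N f (j + d) = \sum_(j <= k < N) f (k + d)%N.
Proof.
case=> _ fN; rewrite /tail big_addn.
have [jN|Nj] := leqP j (N - d).
  rewrite [RHS](big_cat_nat (n := N - d)) ?leq_subr //=.
  rewrite [X in _ + X]big_nat [X in _ + X]big1 ?addr0 // => k kN.
  by apply: fN; lia.
rewrite big_geq; last exact: ltnW.
by rewrite big_nat big1 // => k kN; apply: fN; lia.
Qed.

Lemma tail_cat N f i j : (j <= i)%N -> finseq N f ->
  tail N f j = \sum_(j <= k < i) f k + tail N f i.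
Proof.
move=> ji [_ fN]; have [iN|Ni] := leqP i N; first exact: big_cat_nat.
rewrite /tail [X in _ + X]big_geq ?addr0 1?ltnW //.
have [jN|Nj] := leqP j N; last first.
  by rewrite [RHS]big_nat big_nat !big1 // => k ?; apply: fN; lia.
rewrite [RHS](big_cat_nat jN (ltnW Ni)) /= [X in _ + X]big_nat.
rewrite [X in _ + X]big1 ?addr0 //.
by move=> k ?; apply: fN; lia.
Qed.

(** Once [tail j] is split at [i] and [tail (j + d)] at [i + d], the product [tail i * tail (i + d)]
    cancels. The rest compares termwise, by log-concavity at [k < i <= m]. *)
Lemma lcseq_tail N f : finseq N f -> lcseq f -> lcseq (tail N f).
Proof.
move=> fF lc i j d ji.
rewrite (tail_cat ji fF) (@tail_cat N f (i + d) (j + d)) ?leq_add2r // !mulrDr.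
rewrite [tail N f i * tail _ _ _]mulrC lerD2r tail_addn //.
rewrite mulrC big_distrlr [leRHS]mulrC big_addn addnK big_distrlr /=.
rewrite big_nat [leRHS]big_nat ler_sum // => k /andP[jk ki].
rewrite /tail big_nat [leRHS]big_nat ler_sum // => m /andP[im mN].
by rewrite mulrC [leRHS]mulrC; apply: lc; apply: ltnW (leq_trans ki im).
Qed.

(** Summation by parts; it turns sums of iterated tails into moments of [f]. *)
Lemma sum_tail N f w :
  \sum_(0 <= j < N) w j * tail N f j =
  \sum_(0 <= k < N) f k * \sum_(0 <= j < k.+1) w j.
Proof.
transitivity (\sum_(0 <= j < N) \sum_(0 <= k < N | (j <= k)%N) w j * f k).
  by apply: eq_bigr => j _; rewrite mulr_sumr (big_nat_widenl _ 0).
rewrite (exchange_big_dep_nat predT) //= big_nat [RHS]big_nat.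
apply: eq_bigr => k /andP[_ kN]; rewrite mulr_sumr [RHS](big_nat_widen _ _ N) //=.
by apply: eq_bigr => j _; exact: mulrC.
Qed.

(** This is [B_0 B_2 <= B_1^2], from the termwise bound [f 0 * f (k + j) <= f j * f k]. Applied to
    [tail N f] it gives [B_1 B_3 <= B_2^2]. *)
Lemma tail_sum_le N f : finseq N f -> lcseq f ->
  f 0%N * \sum_(0 <= j < N) tail N f j <= (\sum_(0 <= j < N) f j) ^+ 2.
Proof.
move=> [f0 fN] lc; rewrite expr2 big_distrl mulr_sumr /=.
rewrite big_nat [leRHS]big_nat ler_sum // => j jN; rewrite !mulr_sumr.
rewrite [leRHS](big_cat_nat (n := N - j)) ?leq_subr //=.
have -> : \sum_(j <= k < N) f 0%N * f k = \sum_(0 <= k < N - j) f 0%N * f (k + j)%N.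
  by rewrite -{1}[j]add0n big_addn.
rewrite -[leLHS]addr0 lerD ?sumr_ge0 // => [|k _]; last exact: mulr_ge0.
rewrite ler_sum // => k _.
by have := lc j 0%N k (leq0n j); rewrite add0n addnC mulrC.
Qed.

(** Here [B_0 = f 0], [B_1 = b], [B_2 = u + b] and [B_3 = (w + 3 u + 2 b) / 2], since [f k] enters
    [B_3] with weight [(k + 1) (k + 2) / 2]. The two claims are the inequalities for [r = 1] and
    [r = 2], expanded. *)
Lemma half_moments N f :
  finseq N f -> lcseq f -> let b := \sum_(0 <= k < N) f k in
  let u := \sum_(0 <= k < N) k%:R * f k in
  let w := \sum_(0 <= k < N) k%:R ^+ 2 * f k in
  u * f 0%N <= b * (b - f 0%N) /\ w * b <= 2 * u ^+ 2 + u * b.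
Proof.
move=> fF lc b u w.
have natsum n : \sum_(0 <= j < n.+1) (1 : R) = n%:R + 1.
  by rewrite big_const_nat iter_addr addr0 subn0 -natr1.
have trisum n : \sum_(0 <= j < n.+1) (j%:R + 1 : R) = (n%:R + 1) * (n%:R + 2) / 2.
  elim: n => [|n IHn]; first by rewrite big_nat1; field.
  by rewrite big_nat_recr //= IHn -!natr1; field.
have s1 : \sum_(0 <= j < N) tail N f j = u + b.
  rewrite -big_split /=.
  transitivity (\sum_(0 <= j < N) 1 * tail N f j).
    by apply: eq_bigr => j _; rewrite mul1r.
  by rewrite sum_tail; apply: eq_bigr => k _; rewrite natsum; ring.
have s2 : \sum_(0 <= j < N) tail N (tail N f) j = (w + 3 * u + 2 * b) / 2.
  transitivity (\sum_(0 <= j < N) 1 * tail N (tail N f) j).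
    by apply: eq_bigr => j _; rewrite mul1r.
  rewrite sum_tail; under eq_bigr do rewrite natsum mulrC.
  rewrite (sum_tail N f (fun k => k%:R + 1)) !mulr_sumr -!big_split /= mulr_suml.
  by apply: eq_bigr => k _; rewrite trisum; field.
have := tail_sum_le fF lc; rewrite s1 -/b => i1.
have := tail_sum_le (finseq_tail fF) (lcseq_tail fF lc).
rewrite s1 s2 {1}/tail -/b => i2.
split; nra.
Qed.

(* [F u v := 2 u^2 / b + u + 2 v^2 / c + v - (u - v)^2] is increasing in [u]
   and in [v], since [b, c <= 1]; its largest value is the one of the two-sided
   geometric sequence, [u = b (b - P) / P] and [v = c (c - P) / P]. *)
Lemma moments_bound (P b c u v w x : R) :
  0 < P -> P <= b -> P <= c -> b + c - P = 1 -> 0 <= u -> 0 <= v ->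
  u * P <= b * (b - P) -> v * P <= c * (c - P) ->
  w * b <= 2 * u ^+ 2 + u * b -> x * c <= 2 * v ^+ 2 + v * c ->
  P ^+ 2 * (1 + 4 * (w + x - (u - v) ^+ 2)) <= 4.
Proof.
move=> P0 Pb Pc bc u0 v0 uU vV wu xv.
have b0 : 0 < b by exact: lt_le_trans Pb.
have c0 : 0 < c by exact: lt_le_trans Pc.
pose F u v := 2 * u ^+ 2 / b + u + (2 * v ^+ 2 / c + v) - (u - v) ^+ 2.
have wF : w <= 2 * u ^+ 2 / b + u.
  by rewrite -(ler_pM2r b0) mulrDl divfK // gt_eqF.
have xF : x <= 2 * v ^+ 2 / c + v.
  by rewrite -(ler_pM2r c0) mulrDl divfK // gt_eqF.
(* The square terms of [F] in [u] have coefficient [2 / b - 1 >= 1]; the other terms, [u + 2 u v],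
   increase because [v >= 0]. The same holds with the roles exchanged. *)
have mono (s t y : R) : 0 < s <= 1 -> 0 <= t <= y ->
    2 * t ^+ 2 / s - t ^+ 2 <= 2 * y ^+ 2 / s - y ^+ 2.
  move=> /andP[s0 s1] /andP[t0 ty].
  have h : 0 <= (y ^+ 2 - t ^+ 2) by nra.
  have : (y ^+ 2 - t ^+ 2) * 1 <= (y ^+ 2 - t ^+ 2) * s^-1.
    by apply: ler_wpM2l; rewrite ?invf_ge1.
  rewrite mulr1 mulrBl -!mulrA; lra.
pose U := b * (b - P) / P; pose V := c * (c - P) / P.
have uU' : u <= U by rewrite ler_pdivlMr.
have vV' : v <= V by rewrite ler_pdivlMr.
have F1 : F u v <= F U v.
  have : 2 * u ^+ 2 / b - u ^+ 2 <= 2 * U ^+ 2 / b - U ^+ 2.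
    by apply: mono; [lra | rewrite u0].
  by rewrite /F; nra.
have F2 : F U v <= F U V.
  have : 2 * v ^+ 2 / c - v ^+ 2 <= 2 * V ^+ 2 / c - V ^+ 2.
    by apply: mono; [lra | rewrite v0].
  have : 0 <= U by lra.
  by rewrite /F; nra.
have FUV : P ^+ 2 * (1 + 4 * F U V) = 4 - 8 * (b - P / 2) * (c - P / 2) - P ^+ 2.
  have -> : c = 1 + P - b by lra.
  rewrite /F /U /V.
  have -> : c = 1 + P - b by lra.
  by field; rewrite !gt_eqF //; lra.
apply: (@le_trans _ _ (P ^+ 2 * (1 + 4 * F U V))).
  rewrite ler_wpM2l ?sqr_ge0 //; rewrite /F in F1 F2 *; lra.
(* Both factors [b - P / 2] and [c - P / 2] are at least [P / 2]. *)
rewrite FUV; nra.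
Qed.

(** Adjacent ratios decrease, and ratios over distance [d] are products of adjacent ones. Positivity
    below [N] allows the intermediate factor to be cancelled in both inductions. *)
Lemma lcseq_adjacent N f : finseq N f ->
  (forall k, (k < N)%N -> 0 < f k) ->
  (forall k, (k.+2 < N)%N -> f k * f k.+2 <= f k.+1 ^+ 2) -> lcseq f.
Proof.
move=> [f0 fN] f_gt0 adj.
have step i j : (j <= i)%N -> f i.+1 * f j <= f i * f j.+1.
  move=> /subnK <-; elim: (i - j)%N => [|e IHe]; first by rewrite mulrC.
  rewrite addSn; set k := (e + j)%N in IHe *.
  have [kN|Nk] := ltnP k.+2 N; last by rewrite (fN k.+2) // mul0r mulr_ge0.
  have k0 : 0 < f k by apply: f_gt0; lia.
  rewrite -(ler_pM2l k0) mulrA.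
  apply: (@le_trans _ _ (f k.+1 * (f k.+1 * f j))).
    by rewrite mulrA -expr2 ler_wpM2r // adj.
  by rewrite [leRHS]mulrCA; apply: ler_wpM2l.
move=> i j d ji; elim: d => [|d IHd]; first by rewrite !addn0.
rewrite !addnS.
have [kN|Nk] := ltnP (i + d).+1 N; last first.
  by rewrite (fN (i + d).+1) // mul0r mulr_ge0.
have k0 : 0 < f (j + d)%N by apply: f_gt0; lia.
rewrite -(ler_pM2l k0).
apply: (@le_trans _ _ (f (i + d)%N * f (j + d).+1 * f j)).
  by rewrite mulrA [f (j + d)%N * _]mulrC ler_wpM2r // step ?leq_add2r.
by rewrite mulrAC [leRHS]mulrA ler_wpM2r // [leRHS]mulrC.
Qed.

(** The sequence read leftwards from [m]. Without the test, truncated subtraction would repeat [f 0]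
    for every [k > m]. *)
Definition reflect f m k := if (k <= m)%N then f (m - k)%N else 0.

Lemma finseq_shift N f m : finseq N f -> finseq N (fun k => f (m + k)%N).
Proof. by case=> f0 fN; split=> k // Nk; apply: fN; lia. Qed.

Lemma lcseq_shift f m : lcseq f -> lcseq (fun k => f (m + k)%N).
Proof. by move=> lc i j d ji; rewrite !addnA; apply: lc; rewrite leq_add2l. Qed.

Lemma finseq_reflect N f m : (m < N)%N -> finseq N f -> finseq N (reflect f m).
Proof.
move=> mN [f0 fN]; rewrite /reflect; split=> k; first by case: ifP.
by move=> Nk; rewrite leqNgt (leq_trans mN Nk).
Qed.

Lemma lcseq_reflect N f m : finseq N f -> lcseq f -> lcseq (reflect f m).
Proof.
move=> [f0 fN] lc i j d ji; rewrite /reflect.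
have [idm|mid] := leqP (i + d) m; last first.
  by rewrite mul0r; do 2?case: ifP => _; rewrite ?mulr0 ?mul0r ?mulr_ge0.
rewrite !ifT; try lia.
have := lc (m - (j + d))%N (m - (i + d))%N d.
have -> : (m - (j + d) + d = m - j)%N by lia.
have -> : (m - (i + d) + d = m - i)%N by lia.
by rewrite mulrC [leRHS]mulrC; apply; lia.
Qed.

Lemma sum_reflect (F : nat -> R) m :
  \sum_(0 <= k < m.+1) F (m - k)%N = \sum_(0 <= k < m.+1) F k.
Proof.
rewrite big_nat_rev /= big_nat [RHS]big_nat; apply: eq_bigr => k km.
by congr F; lia.
Qed.

(** Both halves contain [F m], which is subtracted once. For [F = p] this gives the relation
    [b + c - P = 1] of [moments_bound]; for moments about [m] the correction is zero. *)
Lemma sum_around (F : nat -> R) N m : (m < N)%N ->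
  (forall k, (N <= k)%N -> F k = 0) ->
  \sum_(0 <= k < N) F k = \sum_(0 <= k < N) F (m + k)%N +
    \sum_(0 <= k < N) (if (k <= m)%N then F (m - k)%N else 0) - F m.
Proof.
move=> mN FN.
have -> : \sum_(0 <= k < N) F (m + k)%N = \sum_(m <= k < N) F k.
  rewrite [LHS](big_cat_nat (n := N - m)) ?leq_subr //=.
  rewrite [X in _ + X]big_nat [X in _ + X]big1 => [|k ?]; last by apply: FN; lia.
  rewrite addr0 -[m in RHS]add0n big_addn.
  by apply: eq_bigr => k _; rewrite addnC.
have -> : \sum_(0 <= k < N) (if (k <= m)%N then F (m - k)%N else 0) =
    \sum_(0 <= k < m.+1) F k.
  rewrite -sum_reflect [RHS](big_nat_widen _ _ N) //= [RHS]big_mkcond /=.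
  by apply: eq_bigr => k _; rewrite ltnS.
rewrite (big_cat_nat (leq0n m) (ltnW mN)) /= [X in _ = _ + X - _]big_nat_recr //=.
ring.
Qed.

(** * Variance and the largest probability *)

Section Distribution.
Variables (N : nat) (p : nat -> R).
Hypotheses (pF : finseq N p) (p_lc : lcseq p).
Hypothesis p1 : \sum_(0 <= k < N) p k = 1.

Definition mean f M := \sum_(0 <= k < M) k%:R * f k.
Definition variance f M := \sum_(0 <= k < M) (k%:R - mean f M) ^+ 2 * f k.

Lemma variance_around (a : R) : variance p N =
  \sum_(0 <= k < N) (k%:R - a) ^+ 2 * p k -
  (\sum_(0 <= k < N) (k%:R - a) * p k) ^+ 2.
Proof.
have dE : \sum_(0 <= k < N) (k%:R - a) * p k = mean p N - a.
  rewrite -[a in RHS]mulr1 -[X in a * X]p1 mulr_sumr -sumrB.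
  by apply: eq_bigr => k _; ring.
rewrite /variance dE; set mu := mean p N.
transitivity (\sum_(0 <= k < N) (k%:R - a) ^+ 2 * p k
    - 2 * (mu - a) * \sum_(0 <= k < N) (k%:R - a) * p k
    + (mu - a) ^+ 2 * \sum_(0 <= k < N) p k); last by rewrite dE p1 -/mu; ring.
by rewrite !mulr_sumr -sumrB -big_split /=; apply: eq_bigr => k _; ring.
Qed.

Lemma max_bound m : p m ^+ 2 * (1 + 4 * variance p N) <= 4.
Proof.
have [p0 pN] := pF.
have [Nm|mN] := leqP N m; first by rewrite pN // expr0n mul0r.
have [pm0|pm0] := eqVneq (p m) 0; first by rewrite pm0 expr0n mul0r.
have fF := finseq_shift m pF; have fl := lcseq_shift m p_lc.
have gF := finseq_reflect mN pF; have gl := lcseq_reflect m pF p_lc.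
have [u1 w1] := half_moments fF fl; have [v1 x1] := half_moments gF gl.
have r0 : reflect p m 0 = p m by rewrite /reflect /= subn0.
rewrite addn0 in u1; rewrite r0 in v1.
have ge_first f : finseq N f -> f 0%N <= \sum_(0 <= k < N) f k.
  case=> f0 _; rewrite big_ltn ?(leq_ltn_trans _ mN) //.
  by rewrite lerDl sumr_ge0.
have mom_ge0 f : finseq N f -> 0 <= \sum_(0 <= k < N) k%:R * f k.
  by case=> f0 _; rewrite sumr_ge0 // => k _; rewrite mulr_ge0.
have := @moments_bound (p m) _ _ _ _ _ _ _ _ _ _
  (mom_ge0 _ fF) (mom_ge0 _ gF) u1 v1 w1 x1.
set u := \sum_(0 <= k < N) k%:R * _; set v := \sum_(0 <= k < N) k%:R * _.
set w := \sum_(0 <= k < N) k%:R ^+ 2 * _.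
set x := \sum_(0 <= k < N) k%:R ^+ 2 * _.
(* Offsets from [m] are negative in the reflected half, so first moments subtract while second
   moments add. *)
have uv : u - v = \sum_(0 <= k < N) (k%:R - m%:R) * p k.
  rewrite (sum_around mN) => [|k /pN ->]; last by rewrite mulr0.
  rewrite subrr mul0r subr0 -sumrN; congr (_ + _); apply: eq_bigr => k _.
    by rewrite natrD addrC addKr.
  rewrite /reflect; case: leqP => [km|_]; last by rewrite mulr0 oppr0.
  by rewrite natrB //; ring.
have wx : w + x = \sum_(0 <= k < N) (k%:R - m%:R) ^+ 2 * p k.
  rewrite (sum_around mN) => [|k /pN ->]; last by rewrite mulr0.
  rewrite subrr expr0n mul0r subr0; congr (_ + _); apply: eq_bigr => k _.
    by rewrite natrD addrC addKr.
  rewrite /reflect; case: leqP => [km|_]; last by rewrite mulr0.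
  by rewrite natrB //; ring.
rewrite (variance_around m%:R) -uv -wx; apply.
- by rewrite lt_neqAle eq_sym pm0 p0.
- by have := ge_first _ fF; rewrite addn0.
- by have := ge_first _ gF; rewrite r0.
by rewrite -p1 (sum_around mN pN).
Qed.

End Distribution.

Lemma mean_reflect n f : \sum_(0 <= k < n.+1) f k = 1 ->
  mean (reflect f n) n.+1 = n%:R - mean f n.+1.
Proof.
move=> f1; rewrite -[X in X - _]mulr1 -[X in n%:R * X]f1.
rewrite /mean mulr_sumr -sumrB -sum_reflect.
rewrite big_nat [RHS]big_nat; apply: eq_bigr => k /andP[_]; rewrite ltnS => kn.
by rewrite /reflect leq_subr subKn // natrB //; ring.
Qed.

Lemma variance_reflect n f : \sum_(0 <= k < n.+1) f k = 1 ->
  variance (reflect f n) n.+1 = variance f n.+1.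
Proof.
move=> f1; rewrite /variance mean_reflect // -sum_reflect.
rewrite big_nat [RHS]big_nat; apply: eq_bigr => k /andP[_]; rewrite ltnS => kn.
by rewrite /reflect leq_subr subKn // natrB //; ring.
Qed.

End LogConcave.

(** * Exponential decay of the tails *)

Section ExponentialTail.
Variable R : realType.

Lemma tail_window (s : R) (N : nat) (p : nat -> R) : finseq N p ->
  \sum_(0 <= k < N) p k = 1 -> 0 < s -> variance p N <= s ^+ 2 ->
  exists m d : nat, [/\ (0 < d)%N, d%:R <= 4 * s + 2,
    (m + d)%:R <= mean p N + 2 * s + 1,
    3 / 4 <= tail N p m & tail N p (m + d) <= 1 / 4].
Proof.
move=> pF p1 s0 var_s; have [p0 pN] := pF; set mu := mean p N.
have mu0 : 0 <= mu by rewrite sumr_ge0 // => k _; rewrite mulr_ge0.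
have cheb (P : pred nat) : (forall k, P k -> 4 * s ^+ 2 <= (k%:R - mu) ^+ 2) ->
    \sum_(0 <= k < N | P k) p k <= 1 / 4.
  move=> far; rewrite -(ler_pM2l (_ : 0 < 4 * s ^+ 2)); last first.
    by rewrite mulr_gt0 ?exprn_gt0.
  apply: (@le_trans _ _ (s ^+ 2)); last lra.
  apply: le_trans var_s; rewrite /variance mulr_sumr big_mkcond ler_sum // => k _.
  case: ifP => [/far|_]; last by rewrite mulr_ge0 ?sqr_ge0.
  by move=> ?; rewrite ler_wpM2r.
(* Two standard deviations on each side leave mass at most 1/4 outside; rounding to integers costs
   at most 1 at each end, hence the length [4 s + 2]. *)
pose m := Num.truncn (mu - 2 * s); pose k := (Num.truncn (mu + 2 * s)).+1.
have ms : mu - 2 * s < m.+1%:R by rewrite truncnS_gt.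
have ks : mu + 2 * s < k%:R by rewrite truncnS_gt.
have kl : k%:R <= mu + 2 * s + 1.
  by rewrite /k -natr1 lerD2r truncn_le; lra.
have mk : (m < k)%N by rewrite ltnS le_truncn //; lra.
have tk : tail N p k <= 1 / 4.
  rewrite /tail (big_nat_widenl _ 0) //; apply: cheb => j /= kj.
  have : k%:R <= j%:R :> R by rewrite ler_nat.
  nra.
have tm : 3 / 4 <= tail N p m.
  rewrite /tail (big_nat_widenl _ 0) //=.
  have : \sum_(0 <= j < N | ~~ (m <= j)%N) p j <= 1 / 4.
    apply: cheb => j; rewrite -ltnNge => jm.
    have : j%:R <= m%:R :> R by rewrite ler_nat ltnW.
    (* If [mu - 2 s] is negative, [truncn] is 0 and not the floor; but an index [j < m] forces
       [m > 0]. *)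
    have : m%:R <= mu - 2 * s.
      rewrite truncn_le; have := leq_trans (ltn0Sn j) jm; rewrite truncn_gt0.
      exact: le_trans ler01.
    nra.
  by have := p1; rewrite (bigID (fun j => m <= j)%N) /=; lra.
have km : (m + (k - m) = k)%N by rewrite subnKC // ltnW.
exists m, (k - m)%N; rewrite km subn_gt0.
split; [by [] | | by [] | by [] | by []].
rewrite natrB; last exact: ltnW.
rewrite -natr1 in ms; lra.
Qed.

(** From [exp (- 1/6) >= 5/6] follows [e <= (6/5)^6 < 3]. A drop by a factor 3 is therefore worth a
    full unit in the exponent. *)
Lemma expR1_le3 : expR (1 : R) <= 3.
Proof.
have h : expR (- (6^-1) : R) >= 5 / 6.
  by apply: le_trans (expR_ge1Dx _); lra.
have : expR (1 : R) * (expR (- (6^-1))) ^+ 6 = 1.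
  by rewrite -expRM_natl -expRD -[RHS]expR0; congr expR; field.
have h6 : (5 / 6 : R) ^+ 6 <= expR (- 6^-1) ^+ 6.
  by rewrite lerXn2r ?nnegrE ?expR_ge0 //; lra.
have e0 := expR_ge0 (1 : R).
have : expR (1 : R) * (5 / 6) ^+ 6 <= expR 1 * expR (- 6^-1) ^+ 6.
  by rewrite ler_wpM2l.
lra.
Qed.

Lemma tail_le_expR (s : R) (N : nat) (p : nat -> R) : finseq N p -> lcseq p ->
  \sum_(0 <= k < N) p k = 1 -> 0 < s -> variance p N <= s ^+ 2 ->
  forall l, tail N p l <= 2 * expR (- ((l%:R - mean p N) / (4 * s + 2))).
Proof.
move=> pF p_lc p1 s0 var_s l; set mu := mean p N; set r := 4 * s + 2.
have [m [d [d0 dr kmu tm tk]]] := tail_window pF p1 s0 var_s.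
have r0 : 0 < r by rewrite /r; lra.
have tlc := lcseq_tail pF p_lc; have [t0 _] := finseq_tail pF.
have e1 : 3^-1 <= expR (- 1 : R).
  by rewrite expRN lef_pV2 ?posrE ?expR_gt0 // expR1_le3.
have ehalf : 2^-1 <= expR (- 2^-1 : R).
  by apply: le_trans (expR_ge1Dx _); lra.
have tail_le i j : (i <= j)%N -> tail N p j <= tail N p i.
  move=> ij; rewrite (tail_cat ij pF) lerDr sumr_ge0 // => k _.
  by case: pF.
have tail1 i : tail N p i <= 1.
  by rewrite -p1; apply: (tail_le 0%N).
elim/ltn_ind: l => l IHl.
(* Here [l - mu <= r / 2], so the bound is at least [2 exp (- 1/2) >= 1]. *)
have [lk|kl] := ltnP l (m + d).
  apply: (@le_trans _ _ 1) => //.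
  apply: (@le_trans _ _ (2 * expR (- 2^-1))); first lra.
  rewrite ler_pM2l // ler_expR lerN2 ler_pdivrMr //.
  have : l%:R <= (m + d)%:R :> R by rewrite ler_nat ltnW.
  rewrite /r -/mu in kmu *; lra.
(* Here [l - mu <= 3 r / 2], so the bound is at least [2 exp (- 3/2) >= 1/3], while the tail is at
   most 1/4. *)
have [lkd|kdl] := ltnP l (m + d + d).
  apply: (@le_trans _ _ (1 / 4)); first exact: le_trans (tail_le _ _ kl) tk.
  apply: (@le_trans _ _ (2 * expR (- 1 + - 2^-1))).
    rewrite expRD; nra.
  rewrite ler_pM2l // ler_expR -opprD lerN2 ler_pdivrMr //.
  have : l%:R <= (m + d)%:R + d%:R :> R by rewrite -natrD ler_nat ltnW.
  rewrite /r -/mu in kmu dr *; lra.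
have dl : (d <= l)%N := leq_trans (leq_addl _ _) kdl.
have lE : l = (l - d + d)%N by rewrite subnK.
(* Log-concavity of the tails carries the ratio [(1/4) / (3/4)] of the window at [m] over to the
   window ending at [l]. *)
have step : 3 * tail N p l <= tail N p (l - d).
  have ml : (m <= l - d)%N.
    by rewrite leq_subRL // addnC; exact: leq_trans (leq_addr _ _) kdl.
  have := tlc (l - d)%N m d ml; rewrite -lE.
  have := t0 l; have := t0 (l - d)%N; nra.
have ldl : (l - d < l)%N by rewrite ltn_subrL d0 (leq_trans d0 dl).
have := IHl _ ldl; rewrite (natrB _ dl) => h.
apply: (@le_trans _ _ (2 * expR (- ((l%:R - d%:R - mu) / r) + - 1))).
  rewrite expRD; have := expR_ge0 (- ((l%:R - d%:R - mu) / r)).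
  nra.
rewrite ler_pM2l // ler_expR -opprD lerN2 ler_pdivrMr // mulrDl.
by rewrite divfK ?gt_eqF // /r; lra.
Qed.

End ExponentialTail.

(** * The ground state *)

Section GroundState.
Variables (R : realType) (n : nat) (psi : 'cV[R]_n.+1).

(** Extended by zero to all naturals; the test screens off the default value of [inord] out of
    range. *)
Definition gs_prob (k : nat) : R :=
  if (k < n.+1)%N then psi (inord k) 0 ^+ 2 else 0.

Lemma sum_gs_prob (F : nat -> R) :
  \sum_(0 <= k < n.+1) F k * gs_prob k = \sum_(k < n.+1) F k * psi k 0 ^+ 2.
Proof.
rewrite big_mkord; apply: eq_bigr => k _.
by rewrite /gs_prob ltn_ord inord_val.
Qed.

Lemma gs_prob_finseq : finseq n.+1 gs_prob.
Proof.
split=> k; rewrite /gs_prob; first by case: ifP; rewrite ?sqr_ge0.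
by move=> nk; rewrite ltnNge nk.
Qed.

Lemma gs_prob_lcseq : (forall k, 0 < psi k 0) -> log_concave psi -> lcseq gs_prob.
Proof.
move=> psi0 lc; apply: lcseq_adjacent gs_prob_finseq _ _ => k kn; rewrite /gs_prob.
  by rewrite kn exprn_gt0.
have k1 : (k.+1 < n.+1)%N := ltnW kn; have k0 : (k < n.+1)%N := ltnW k1.
have := lc (inord k) (inord k.+1) (inord k.+2).
rewrite !inordK // => /(_ erefl erefl) h.
rewrite kn k1 k0 -exprMn lerXn2r // nnegrE; last exact: sqr_ge0.
by apply: mulr_ge0; exact: ltW.
Qed.

Lemma gs_meanE : gs_mean psi = mean gs_prob n.+1.
Proof. by rewrite /mean sum_gs_prob. Qed.

Lemma gs_varianceE : gs_variance psi = variance gs_prob n.+1.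
Proof. 
by rewrite /variance -gs_meanE (sum_gs_prob (fun k => (k%:R - gs_mean psi) ^+ 2)).
 Qed.

(** Every site has positive mass, so zero variance would make both 0 and [n] equal to the mean. *)
Lemma gs_variance_gt0 : (0 < n)%N -> (forall k, 0 < psi k 0) -> 0 < gs_variance psi.
Proof.
move=> n0 psi0; rewrite lt_neqAle eq_sym.
have ge0 (k : 'I_n.+1) : 0 <= (k%:R - gs_mean psi) ^+ 2 * psi k 0 ^+ 2.
  by rewrite mulr_ge0 ?sqr_ge0.
rewrite sumr_ge0 // andbT; apply/negP => /eqP/psumr_eq0P v0.
have at0 (k : 'I_n.+1) : k%:R = gs_mean psi.
  have /eqP := v0 (fun k _ => ge0 k) k isT.
  rewrite mulf_eq0 !expf_eq0 /= (gt_eqF (psi0 k)) orbF subr_eq0.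
  by move/eqP.
have := at0 ord0; rewrite -(at0 ord_max) /= => /eqP.
by rewrite eqr_nat eq_sym -leqn0 leqNgt n0.
Qed.

End GroundState.

Lemma gs_interval_bound (R : realType) (n : nat) (psi : 'cV[R]_n.+1) (l u : nat) :
  let mu := gs_mean psi in
  let sigma := Num.sqrt (gs_variance psi) in
  let alpha := Num.max (mu - u%:R) (l%:R - mu) in
  (0 < n)%N -> (forall k, 0 < psi k 0) -> \sum_k psi k 0 ^+ 2 = 1 ->
  log_concave psi -> (l <= u <= n.+1)%N ->
  \sum_(l <= k < u) gs_prob psi k <=
  Num.min (2 * (u%:R - l%:R) / Num.sqrt (1 + 4 * sigma ^+ 2))
          (2 * expR (- (alpha / (2 * (2 * sigma + 1))))).
Proof.
move=> mu sigma alpha n0 psi0 psi1 psi_lc /andP[lu un].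
pose p := gs_prob psi.
have pF : finseq n.+1 p := gs_prob_finseq psi.
have p_lc : lcseq p by exact: gs_prob_lcseq.
have p1 : \sum_(0 <= k < n.+1) p k = 1.
  rewrite -psi1 -[RHS](eq_bigr _ (fun k _ => mul1r _)) -(sum_gs_prob psi (fun=> 1)).
  by apply: eq_bigr => k _; rewrite mul1r.
have s0 : 0 < sigma by rewrite sqrtr_gt0; exact: gs_variance_gt0.
have var_s : variance p n.+1 = sigma ^+ 2.
  by rewrite -gs_varianceE sqr_sqrtr // ltW // gs_variance_gt0.
rewrite le_min; apply/andP; split.
  have d0 : 0 < Num.sqrt (1 + 4 * sigma ^+ 2).
    by rewrite sqrtr_gt0 ltr_pwDl // mulr_ge0 ?sqr_ge0.
  have p_le k : p k <= 2 / Num.sqrt (1 + 4 * sigma ^+ 2).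
    rewrite ler_pdivlMr // -(@ler_pXn2r _ 2) ?nnegrE ?mulr_ge0 ?sqrtr_ge0 //;
      last by case: pF.
    rewrite exprMn sqr_sqrtr; last by have := sqr_ge0 sigma; lra.
    have := max_bound pF p_lc p1 k; rewrite var_s; lra.
  apply: (@le_trans _ _ (\sum_(l <= k < u) (2 / Num.sqrt (1 + 4 * sigma ^+ 2)))).
    exact: ler_sum.
  by rewrite sumr_const_nat -[leLHS]mulr_natr natrB // mulrAC.
have rE : 2 * (2 * sigma + 1) = 4 * sigma + 2 by ring.
have r0 : 0 < 4 * sigma + 2 by lra.
have [p0 pN] := pF.
(* If [alpha = l - mu], the interval lies in the tail from [l]. Otherwise [alpha = mu - u], and
   reflection about [n] sends everything below [u] to the tail from [n + 1 - u]. *)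
rewrite rE /alpha; have [_|_] := leP (mu - u%:R) (l%:R - mu).
  apply: (@le_trans _ _ (tail n.+1 p l)).
    by rewrite /tail (big_cat_nat lu un) /= lerDl sumr_ge0.
  by rewrite /mu gs_meanE; apply: tail_le_expR; rewrite ?var_s.
have qF := finseq_reflect (ltnSn n) pF.
have q_lc := lcseq_reflect n pF p_lc.
have q1 : \sum_(0 <= k < n.+1) reflect p n k = 1.
  rewrite -p1 -[RHS]sum_reflect big_nat [RHS]big_nat; apply: eq_bigr => k.
  by rewrite ltnS /reflect => /andP[_ ->].
have qv : variance (reflect p n) n.+1 <= sigma ^+ 2.
  by rewrite variance_reflect // var_s.
apply: (@le_trans _ _ (tail n.+1 (reflect p n) (n.+1 - u))).
  apply: (@le_trans _ _ (\sum_(0 <= k < u) p k)).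
    by rewrite [leRHS](big_cat_nat (leq0n l) lu) /= lerDr sumr_ge0.
  rewrite (big_nat_widen _ _ n.+1) //= big_mkcond -sum_reflect /tail.
  rewrite [leRHS](big_nat_widenl _ 0) //= [leRHS]big_mkcond.
  rewrite [leLHS]big_nat [leRHS]big_nat.
  rewrite ler_sum // => k /andP[_]; rewrite ltnS => kn; rewrite /reflect kn.
  suff -> : (n - k < u)%N = (n.+1 - u <= k)%N by [].
  by rewrite ltn_subLR // leq_subLR addnC.
apply: le_trans (tail_le_expR qF q_lc q1 s0 qv _) _.
(* The reflected mean is [n - mu], at distance [mu - u + 1] from [n + 1 - u]: one more than
   needed. *)
rewrite ler_pM2l // ler_expR lerN2 ler_pM2r ?invr_gt0 // mean_reflect //.
rewrite /mu gs_meanE natrB // -natr1; lra.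
Qed.

Theorem theorem6 (R : realType) (n : nat) (n_ge1 : (1 <= n)%N)
  (a : nat -> R) (a_gt0 : forall k : nat, (1 <= k <= n)%N -> 0 < a k)
  (V : 'I_n.+1 -> R) (psi : 'cV[R]_n.+1)
  (psi_gs : is_ground_state (hamiltonian a V) psi)
  (psi_lc : log_concave psi)
  (h : 'I_n.+1 -> R) (l u : nat) (hbar : R)
  (lu : (l <= u <= n.+1)%N)
  (h_ge0 : forall k : 'I_n.+1, 0 <= h k)
  (h_supp : forall k : 'I_n.+1, ~~ (l <= k < u)%N -> h k = 0)
  (h_le : forall k : 'I_n.+1, h k <= hbar) :
  let H := hamiltonian a V in
  let mu := gs_mean psi in
  let sigma := Num.sqrt (gs_variance psi) in
  let alpha := Num.max (mu - u%:R) (l%:R - mu) in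
  hbar * Num.min (2 * (u%:R - l%:R) / Num.sqrt (1 + 4 * sigma ^+ 2))
                 (2 * expR (- (alpha / (2 * (2 * sigma + 1)))))
    <= spectral_gap H / 2 ->
  spectral_gap H / 2 <= spectral_gap (H + potential h).
Proof.
have half (x y : R) : y <= x / 2 -> x / 2 <= x - y by lra.
move=> H mu sigma alpha hP; have [_ psi1 psi0] := psi_gs.
have Hs := hamiltonian_sym a V.
apply: (le_trans _ (spectral_gap_perturb n_ge1 Hs psi_gs h_ge0)).
apply: half; apply: le_trans hP.
have hbar0 : 0 <= hbar by apply: le_trans (h_ge0 ord0) (h_le ord0).
apply: le_trans (ler_wpM2l hbar0 (gs_interval_bound n_ge1 psi0 psi1 psi_lc lu)).
have /andP[_ un] := lu.
(* Both sides become sums over all sites: inside the interval [h k <= hbar], outside it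
   [h k = 0]. *)
rewrite (big_nat_widen _ _ n.+1) // (big_nat_widenl _ 0) //= big_mkord mulr_sumr.
rewrite [leRHS]big_mkcond ler_sum // => k _; rewrite /gs_prob ltn_ord inord_val.
rewrite andbC; case: ifP => [_|/negbT/h_supp ->]; last by rewrite mul0r.
by rewrite ler_wpM2r ?sqr_ge0.
Qed.
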